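(* Let $X$ be locally compact regular. Let $\mathcal{A}$ be an algebra of real-valued continuous functions on $X$ vanishing at $\infty$, which separates the points and does not vanish identically at any point of $X$. If $$\sup_{h\in\mathcal{A}}\{-\overline{\Lambda}(h)\}\ge\sup_{x\in X,\,h\in\mathcal{A}}\{h(x)-\underline{\Lambda}(h)\},$$ then $(\mu_\alpha,t_\alpha)$ has a subnet $(\mu_\beta,t_\beta)$ such that $(\mu_\beta)$ satisfies a large deviation principle with powers $(t_\beta)$ and rate function $$J(x)=\sup_{h\in\mathcal{A}}\{h(x)-\Lambda^{(\mu_\beta^{t_\beta})}(h)\}\quad\text{for all }x\in X;$$ moreover $$\sup_{K\in\mathcal{K}}\ \inf_{x\in X\setminus K}J(x)\ge\sup_{x\in X}J(x).$$
   Context: $X$ is a topological space, not reduced to one point, in which compact sets are Borel sets. Locally compact means that each point has a compact neighborhood; ''regular'' does not include Hausdorff. $\mathcal{K}$ is the set of compact subsets of $X$. $(\mu_\alpha)$ is a net of Borel probability measures on $X$ and $(t_\alpha)$ a net (same index set) in $]0,+\infty[$ converging to $0$. Write $\mu_\alpha^{t_\alpha}(A)=(\mu_\alpha(A))^{t_\alpha}$ for Borel $A$, and $\mu_\alpha^{t_\alpha}(e^{h/t_\alpha})=\big(\int_X e^{h(x)/t_\alpha}\mu_\alpha(dx)\big)^{t_\alpha}$ for Borel measurable $h$. Put $\overline\Lambda(h)=\log\limsup\mu_\alpha^{t_\alpha}(e^{h/t_\alpha})$ and $\underline\Lambda(h)=\log\liminf\mu_\alpha^{t_\alpha}(e^{h/t_\alpha})$.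 For a subnet $(\mu_\beta,t_\beta)$, $\Lambda^{(\mu_\beta^{t_\beta})}(h)=\log\lim\mu_\beta^{t_\beta}(e^{h/t_\beta})$, the limit being taken along the subnet; its existence for all $h\in\mathcal{A}$ is part of the assertion. Convention: $\inf\emptyset=+\infty$. Large deviation principle for $(\mu_\beta)$ with powers $(t_\beta)$: for a function $l:X\to[0,+\infty]$, $\limsup\mu_\beta^{t_\beta}(F)\le\sup_{x\in F}e^{-l(x)}$ for all closed $F$ and $\sup_{x\in G}e^{-l(x)}\le\liminf\mu_\beta^{t_\beta}(G)$ for all open $G$; the lower regularization of $l$ (the greatest lower semi-continuous function $\le l$) is then called a rate function. Algebras are real algebras under pointwise operations, not necessarily unital. A continuous function $h$ vanishes at $\infty$ if $\{x:|h(x)|\ge\varepsilon\}$ is compact for every $\varepsilon>0$ (equivalently, $h$ extended by $h(\infty)=0$ is continuous on the one-point compactification of $X$, in which the neighborhoods of $\infty$ are given by complements of closed compact subsets of $X$). $\mathcal{A}$ separates the points if for all $x\ne y$ there is $h\in\mathcal{A}$ with $h(x)\ne h(y)$; it does not vanish identically at any point if for every $x$ there is $h\in\mathcal{A}$ with $h(x)\neq0$. *)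

(* Defs.v *)
From HB Require Import structures.
From mathcomp Require Import all_boot all_order all_algebra.
From mathcomp Require Import all_classical all_reals all_analysis.

Set Implicit Arguments.
Unset Strict Implicit.
Unset Printing Implicit Defensive.

Import Order.TTheory GRing.Theory Num.Theory.
Import numFieldNormedType.Exports.

Local Open Scope classical_set_scope.
Local Open Scope ring_scope.
Local Open Scope ereal_scope.

Definition directed (I : Type) (le : I -> I -> Prop) : Prop :=
  [/\ inhabited I, (forall i, le i i),
      (forall i j k, le i j -> le j k -> le i k)
    & (forall i j, exists k, le i k /\ le j k)].

Definition tails (I : Type) (le : I -> I -> Prop) : set_system I :=
  filter_from [set: I] (fun i => [set j | le i j]).

(* Subnets in the sense of Kelley: the reindexing map is not required to be
   monotone or injective. *)
Definition subnet_map (I J : Type) (leI : I -> I -> Prop)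
    (leJ : J -> J -> Prop) (phi : J -> I) : Prop :=
  directed leJ /\
  forall i, exists j0, forall j, leJ j0 j -> leI i (phi j).

(* [limf_esup] wants its functions to live on a filteredType, which a bare index
   set is not, so the net is first pushed forward to [\bar R]; the lemmas
   [net_limsupE] and [net_liminfE] give the usual formulas. *)
Definition net_limsup (R : realType) (I : Type) (le : I -> I -> Prop)
  (u : I -> \bar R) : \bar R := limf_esup id (u @ tails le).

Definition net_liminf (R : realType) (I : Type) (le : I -> I -> Prop)
  (u : I -> \bar R) : \bar R := limf_einf id (u @ tails le).

Lemma net_limsupE (R : realType) (I : Type) (le : I -> I -> Prop)
    (u : I -> \bar R) :
  net_limsup le u =
  ereal_inf [set ereal_sup [set u j | j in [set j | le i j]] | i in [set: I]].
Proof.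
apply/eqP; rewrite eq_le; apply/andP; split; apply: le_ereal_inf_tmp.
- move=> _ [i _ <-]; apply: ereal_inf_lbound; exists (u @` [set j | le i j]).
    by exists i => // j ij; exists j.
  by rewrite image_id.
- move=> _ [V [i _ iV] <-]; rewrite image_id.
  apply: (@le_trans _ _ (ereal_sup [set u j | j in [set j | le i j]])).
    by apply: ereal_inf_lbound; exists i.
  by apply: ereal_sup_le => _ [j ij <-]; exact: iV.
Qed.

Lemma net_liminfE (R : realType) (I : Type) (le : I -> I -> Prop)
    (u : I -> \bar R) :
  net_liminf le u =
  ereal_sup [set ereal_inf [set u j | j in [set j | le i j]] | i in [set: I]].
Proof.
rewrite /net_liminf limf_einfE.
apply/eqP; rewrite eq_le; apply/andP; split; apply: ge_ereal_sup.
- move=> _ [V [i _ iV] <-]; rewrite image_id.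
  apply: (@le_trans _ _ (ereal_inf [set u j | j in [set j | le i j]])).
    by apply: ereal_inf_le_tmp => _ [j ij <-]; exact: iV.
  by apply: ereal_sup_ubound; exists i.
- move=> _ [i _ <-]; apply: ereal_sup_ubound; exists (u @` [set j | le i j]).
    by exists i => // j ij; exists j.
  by rewrite image_id.
Qed.

(* The library only puts sigma-algebras on pointed types, whence
   [ptopologicalType]; the point plays no other role. *)
Notation borel X := (g_sigma_algebraType (@open X)).

(* In regular spaces this agrees with [locally_compact [set: X]], which moreover
   asks for the compact neighborhoods to be closed. *)
Definition locally_compact_space (X : topologicalType) : Prop :=
  forall x : X, exists2 K : set X, nbhs x K & compact K.

Definition vanishes_at_infinity (R : realType) (X : topologicalType)
    (h : X -> R) : Prop :=
  forall e : R, (0 < e)%R -> compact [set x | (e <= `|h x|)%R].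

Definition function_algebra (R : realType) (X : Type) (A : set (X -> R)) :
    Prop :=
  [/\ A (fun=> 0%R),
      (forall f g, A f -> A g -> A (fun x => f x + g x)%R),
      (forall (c : R) f, A f -> A (fun x => c * f x)%R)
    & (forall f g, A f -> A g -> A (fun x => f x * g x)%R)].

Definition separates_points (R : realType) (X : Type) (A : set (X -> R)) :
    Prop :=
  forall x y, x <> y -> exists2 h, A h & h x <> h y.

Definition vanishes_nowhere (R : realType) (X : Type) (A : set (X -> R)) :
    Prop :=
  forall x, exists2 h, A h & h x <> 0%R.

Definition exp_moment (R : realType) (X : ptopologicalType)
    (m : probability (borel X) R) (s : R) (h : X -> R) : \bar R :=
  (\int[m]_x (expR (h x / s))%:E) `^ s.

Definition Lambda_sup (R : realType) (X : ptopologicalType) (I : Type)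
    (le : I -> I -> Prop) (mu : I -> probability (borel X) R) (t : I -> R)
    (h : X -> R) : \bar R :=
  lne (net_limsup le (fun i => exp_moment (mu i) (t i) h)).

Definition Lambda_inf (R : realType) (X : ptopologicalType) (I : Type)
    (le : I -> I -> Prop) (mu : I -> probability (borel X) R) (t : I -> R)
    (h : X -> R) : \bar R :=
  lne (net_liminf le (fun i => exp_moment (mu i) (t i) h)).

Definition Lambda_exists (R : realType) (X : ptopologicalType) (I : Type)
    (le : I -> I -> Prop) (mu : I -> probability (borel X) R) (t : I -> R)
    (h : X -> R) : Prop :=
  cvg (exp_moment (mu i) (t i) h @[i --> tails le]).

(* Only meaningful under [Lambda_exists]. *)
Definition Lambda (R : realType) (X : ptopologicalType) (I : Type)
    (le : I -> I -> Prop) (mu : I -> probability (borel X) R) (t : I -> R)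
    (h : X -> R) : \bar R :=
  lne (lim (exp_moment (mu i) (t i) h @[i --> tails le])).

(* The supremum is taken in [0, +oo]: adding 0 only matters for [A = set0]. *)
Definition sup_expN (R : realType) (X : Type) (l : X -> \bar R) (A : set X) :
    \bar R :=
  ereal_sup (0 |` [set expeR (- l x) | x in A]).

Definition LDP_bounds (R : realType) (X : ptopologicalType) (I : Type)
    (le : I -> I -> Prop) (mu : I -> probability (borel X) R) (t : I -> R)
    (l : X -> \bar R) : Prop :=
  (forall F : set X, closed F ->
     net_limsup le (fun i => mu i F `^ t i) <= sup_expN l F) /\
  (forall G : set X, open G ->
     sup_expN l G <= net_liminf le (fun i => mu i G `^ t i)).

Definition lower_regularization (R : realType) (X : topologicalType)
    (l J : X -> \bar R) : Prop :=
  [/\ lower_semicontinuous J, (forall x, J x <= l x)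
    & forall g : X -> \bar R, lower_semicontinuous g ->
        (forall x, g x <= l x) -> forall x, g x <= J x].

Definition LDP_with_rate (R : realType) (X : ptopologicalType) (I : Type)
    (le : I -> I -> Prop) (mu : I -> probability (borel X) R) (t : I -> R)
    (J : X -> \bar R) : Prop :=
  exists l : X -> \bar R,
    [/\ (forall x, 0 <= l x), LDP_bounds le mu t l & lower_regularization l J].

Definition rate_of (R : realType) (X : ptopologicalType) (I : Type)
    (le : I -> I -> Prop) (mu : I -> probability (borel X) R) (t : I -> R)
    (A : set (X -> R)) (x : X) : \bar R :=
  ereal_sup [set (h x)%:E - Lambda le mu t h | h in A].

(* Main.v *)
Require Import Defs.
From HB Require Import structures.
From mathcomp Require Import all_boot all_order all_algebra.
From mathcomp Require Import all_classical all_reals all_analysis.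
From mathcomp Require Import measurable_realfun ring lra.
Set Implicit Arguments.
Unset Strict Implicit.
Unset Printing Implicit Defensive.
Import Order.TTheory GRing.Theory Num.Theory.
Import numFieldNormedType.Exports.
Local Open Scope classical_set_scope.
Local Open Scope ring_scope.
Local Open Scope ereal_scope.

(* Along a universal subnet the set function cap(B) = lim nu(B)^s and the
   functional Lambda exist, and cap (B `|` C) = max (cap B) (cap C). The lower
   bound on open sets needs, for x in an open G, members of A that are nearly c
   at x, at most c, and nearly at most 0 off G: powers of the functions of R + A
   that peak at x, minus their values at infinity, do the job, so the
   Stone-Weierstrass theorem is avoided. Chernoff's inequality yields the upper
   bound on compact sets, and also cap (~` {|h| >= e}) <= exp (e + Lambda h).
   The hypothesis says that the infimum of the right-hand sides is at most
   exp (- sup J); the complement of a large compact set is thus negligible in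
   front of any point of X, whence the upper bound on closed sets and the
   tightness of J. *)

(** * Limits along ultrafilters and universal subnets *)

Section limits.

Lemma lte_between (R : realType) (a b : \bar R) :
  a < b -> exists y : R, a < y%:E /\ y%:E < b.
Proof.
case: a b => [a| |] [b| |] //= ab.
- by exists ((a + b) / 2)%R; rewrite !lte_fin in ab *; split; lra.
- by exists (a + 1)%R; rewrite lte_fin ltry ltrDl ltr01.
- by exists (b - 1)%R; rewrite lte_fin ltNyr ltrBlDr ltrDl ltr01.
- by exists 0%R; rewrite ltNyr ltry.
Qed.

Lemma lte_le_real (R : realType) (a b : \bar R) :
  (forall y : R, b < y%:E -> a <= y%:E) -> a <= b.
Proof.
move=> ab; rewrite leNgt; apply/negP => /lte_between[y [by_ ya]].
by have := ab _ by_; rewrite leNgt ya.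
Qed.

Context {R : realType} {T : Type} {F : set_system T} {FF : ProperFilter F}.
Implicit Types (u v : T -> \bar R) (c : \bar R).

Lemma le_limsup_near u c : (\forall j \near F, u j <= c) ->
  limf_esup id (u @ F) <= c.
Proof.
move=> uc; apply: (@le_trans _ _ (ereal_sup (id @` [set x | x <= c]))).
  by rewrite /limf_esup; apply: ereal_inf_lbound; exists [set x | x <= c].
by apply: ge_ereal_sup => _ [x xc <-].
Qed.

Lemma near_lt_limsup u c : limf_esup id (u @ F) < c ->
  \forall j \near F, u j < c.
Proof.
move=> /ereal_inf_lt[_ [V FV <-]]; rewrite image_id => Vc.
have {}FV : F (u @^-1` V) := FV.
apply: filterS FV => j Vuj; apply: le_lt_trans Vc.
exact: ereal_sup_ubound.
Qed.

Lemma le_liminf_near u c : (\forall j \near F, c <= u j) ->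
  c <= limf_einf id (u @ F).
Proof.
move=> uc; rewrite limf_einfE.
apply: (@le_trans _ _ (ereal_inf (id @` [set x | c <= x]))).
  by apply: le_ereal_inf_tmp => _ [x xc <-].
by apply: ereal_sup_ubound; exists [set x | c <= x].
Qed.

Lemma le_liminf_limsup u : limf_einf id (u @ F) <= limf_esup id (u @ F).
Proof.
rewrite limf_einfE; apply: ge_ereal_sup => _ [V FV <-].
apply: le_ereal_inf_tmp => _ [W FW <-]; rewrite !image_id.
have [j [Vj Wj]] := filter_ex (filterI FV FW).
by apply: (@le_trans _ _ j); [exact: ereal_inf_lbound|exact: ereal_sup_ubound].
Qed.

(** A real strictly between the two values would cut off a half-line such that neither it nor its
    complement belongs to the image filter. *)
Lemma liminf_eq_limsup u :
    (forall B, (u @ F) B \/ (u @ F) (~` B)) ->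
  limf_einf id (u @ F) = limf_esup id (u @ F).
Proof.
move=> uF; apply/eqP; rewrite eq_le le_liminf_limsup /= leNgt.
apply/negP => /lte_between[y [ly yl]].
have [uy|uy] := uF [set x | x <= y%:E].
  have : limf_esup id (u @ F) <= y%:E by exact: le_limsup_near.
  by rewrite leNgt yl.
have : y%:E <= limf_einf id (u @ F).
  apply: le_liminf_near; apply: filterS (uy : F (u @^-1` _)) => j /= /negP.
  by rewrite -ltNge => /ltW.
by rewrite leNgt ly.
Qed.

Lemma near_lt_liminf u c : c < limf_einf id (u @ F) ->
  \forall j \near F, c < u j.
Proof.
rewrite limf_einfE => /ereal_sup_gt[_ [V FV <-]]; rewrite image_id => Vc.
have {}FV : F (u @^-1` V) := FV.
apply: filterS FV => j Vuj; apply: lt_le_trans Vc _.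
exact: ereal_inf_lbound.
Qed.

Lemma cvg_limsup u :
    (forall B, (u @ F) B \/ (u @ F) (~` B)) ->
  u @ F --> limf_esup id (u @ F).
Proof.
move=> /liminf_eq_limsup uF.
have ub c : limf_esup id (u @ F) < c -> F [set j | u j < c].
  exact: near_lt_limsup.
have lb c : c < limf_esup id (u @ F) -> F [set j | c < u j].
  by rewrite -uF; exact: near_lt_liminf.
move: {uF} (limf_esup _ _) ub lb => l ub lb B Bl.
change (F (u @^-1` B)); move: l ub lb Bl => [l| |] ub lb.
- move=> [e /= e0 eB].
  have le : l%:E < (l + e)%:E by rewrite lte_fin ltrDl.
  have el : (l - e)%:E < l%:E by rewrite lte_fin ltrBlDr ltrDl.
  apply: filterS (filterI (ub _ le) (lb _ el)) => j /= [].
  rewrite /preimage /=; case: (u j) => // r; rewrite !lte_fin => rl lr.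
  by apply: eB => /=; rewrite ltr_norml; lra.
- move=> [M [Mr MB]]; apply: filterS (lb M%:E (ltry _)) => j /= Mj.
  exact: MB.
- move=> [M [Mr MB]]; apply: filterS (ub M%:E (ltNyr _)) => j /= Mj.
  exact: MB.
Qed.

End limits.

Section nets.

Lemma tails_filter (I : Type) (le : I -> I -> Prop) :
  directed le -> ProperFilter (tails le).
Proof.
move=> [[i0] lexx le_trans dir]; apply: filter_from_proper; last first.
  by move=> i _; exists i; exact: lexx.
apply: filter_from_filter; first by exists i0.
move=> i j _ _; have [k [ik jk]] := dir i j; exists k => // l kl.
by split; [exact: le_trans kl|exact: le_trans kl].
Qed.

Lemma subnet_tails (I J : Type) (leI : I -> I -> Prop) (leJ : J -> J -> Prop)
    (phi : J -> I) (P : set I) :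
  subnet_map leI leJ phi -> tails leI P -> tails leJ (phi @^-1` P).
Proof.
move=> [_ sub] [i _ iP]; have [j0 j0i] := sub i.
by exists j0 => // j /j0i; exact: iP.
Qed.

(* The subnet is indexed by the pointed members of an ultrafilter finer than
   the tails. *)
Lemma universal_subnet (I : Type) (le : I -> I -> Prop) : directed le ->
  exists (J : Type) (leJ : J -> J -> Prop) (phi : J -> I),
    subnet_map le leJ phi /\
    forall P : set I, (phi @ tails leJ) P \/ (phi @ tails leJ) (~` P).
Proof.
move=> dir; have FF := tails_filter dir.
have [U [UU FU]] := ultraFilterLemma FF.
have UF : ProperFilter U := ultra_proper.
pose J := {p : set I * I | U p.1 /\ p.1 p.2}.
pose leJ (p q : J) := (sval q).1 `<=` (sval p).1.
pose phi (p : J) := (sval p).2.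
(* For any [x] in [P], an index beyond [(P, x)] carries a subset of [P], hence a point of [P]. *)
have tailsU P : U P -> (phi @ tails leJ) P.
  move=> UP; have [x Px] := filter_ex UP.
  exists (exist _ (P, x) (conj UP Px)) => // -[[Q y] [/= UQ Qy]]; exact.
exists J, leJ, phi; split; last first.
  by move=> P; case: (in_ultra_setVsetC P UU) => /tailsU; [left|right].
split; last first.
  move=> i; have [|j _ ij] := @tailsU [set j | le i j].
    by apply: FU; exists i.
  by exists j.
split.
- have [x _] := filter_ex (filterT : U setT).
  exact: inhabits (exist _ (setT, x) (conj filterT Logic.I)).
- by move=> j.
- by move=> i j k ij jk; exact: subset_trans ij.
- move=> [[P x] [/= UP Px]] [[Q y] [/= UQ Qy]].
  have UPQ : U (P `&` Q) by exact: filterI.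
  have [z PQz] := filter_ex UPQ.
  exists (exist _ (P `&` Q, z) (conj UPQ PQz)).
  by split=> ? [].
Qed.

End nets.

(** * Peak functions *)

Section peak.

(** If [P K] failed, the sets [B] such that [P] holds for [K] minus [B] would form a proper filter
    containing [K]. A cluster point in [K] has a neighborhood [V] with [P V], yet the complement of
    [V] lies in the filter. *)
Lemma compact_ind (X : topologicalType) (K : set X) (P : set X -> Prop) :
  compact K -> P set0 -> (forall C D, C `<=` D -> P D -> P C) ->
  (forall C D, P C -> P D -> P (C `|` D)) ->
  (forall x, K x -> exists2 V, nbhs x V & P V) -> P K.
Proof.
move=> cK P0 PS PU PK; apply: contrapT => nPK.
pose F : set_system X := [set B | P (K `\` B)].
have FF : ProperFilter F.
  apply: Build_ProperFilter_ex.
    move=> B PB; apply: contrapT => /forallNP B0; apply: nPK.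
    by apply: PS PB => x Kx; split=> // /B0.
  split; rewrite /F.
  - by rewrite /= setDT.
  - move=> B C PB PC; apply: PS (PU _ _ PB PC).
    by move=> y [Ky /not_andP[]]; [left|right].
  - by move=> B C BC; apply: PS; exact: setDS.
have [|x [Kx xF]] := cK F _ _.
  by rewrite /F /= setDv.
have [V xV PV] := PK _ Kx.
have [|y [nVy Vy]] := xF (~` V) V _ xV; last exact: nVy.
by rewrite /F /=; apply: PS PV => y [_] /contrapT.
Qed.

Variables (R : realType) (X : topologicalType) (A : set (X -> R)).
Hypothesis A_algebra : function_algebra A.
Hypothesis A_continuous : forall h, A h -> continuous h.
Hypothesis A_vanishing : forall h, A h -> vanishes_at_infinity h.

Local Open Scope ring_scope.

(** Off the compact set where [|h|] is at least 1 the bound 1 works; on it, local bounds are glued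
    by [compact_ind]. *)
Lemma algebra_bounded h : A h -> exists M, forall y, h y <= M.
Proof.
move=> Ah.
have [|C D CD [M DM]|C D [M CM] [N DN]|x _|M KM] :=
  @compact_ind X _ (fun C => exists M, forall y, C y -> h y <= M)
    (A_vanishing Ah ltr01).
- by exists 0.
- by exists M => y /CD; exact: DM.
- exists (Num.max M N) => y [/CM yM|/DN yN]; rewrite le_max.
    by rewrite yM.
  by rewrite yN orbT.
- exists [set y | h y < h x + 1]; last by exists (h x + 1) => y /ltW.
  by apply: (cvgr_lt (h x)); [exact: A_continuous|rewrite ltrDl].
exists (Num.max M 1) => y; rewrite le_max.
have [y1|y1] := leP 1 `|h y|; first by rewrite KM.
by rewrite (le_trans (ler_norm _) (ltW y1)) orbT.
Qed.

(* A pair [(a, h)] stands for the function [a + h] on the one-point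
   compactification of [X]: its value at infinity is [a]. *)
Definition separable_from (x : X) (C : set X) : Prop :=
  exists a h (d : R), [/\ A h, forall y, 0 <= a + h y, a + h x = 0,
    [/\ 0 <= a & 0 < d] & forall y, C y -> d <= a + h y].

Lemma separable_fromS x C D :
  C `<=` D -> separable_from x D -> separable_from x C.
Proof.
by move=> CD [a [h [d [? ? ? ? H]]]]; exists a, h, d; split=> // y /CD/H.
Qed.

Lemma separable_fromU x C D : separable_from x C -> separable_from x D ->
  separable_from x (C `|` D).
Proof.
move=> [a [h [d [Ah h0 hx [a0 d0] hd]]]] [b [g [e [Ag g0 gx [b0 e0] ge]]]].
have [_ AD _ _] := A_algebra.
exists (a + b), (fun y => h y + g y), (Num.min d e); split.
- exact: AD.
- by move=> y; have := h0 y; have := g0 y; lra.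
- by lra.
- by rewrite lt_min d0 e0 addr_ge0.
- move=> y [/hd|/ge] yd; rewrite ge_min; have := h0 y; have := g0 y.
    by move=> ? ?; apply/orP; left; lra.
  by move=> ? ?; apply/orP; right; lra.
Qed.

(** The square of [g - g x] works: expanded, it is the constant [g x ^+ 2], its value at infinity,
    plus a member of [A]. *)
Lemma separable_from_level g x (k : R) : A g -> 0 < k ->
  separable_from x [set y | k <= `|g y - g x|].
Proof.
move=> Ag k0; have [_ AD AZ AM] := A_algebra.
have E y : g x ^+ 2 + (g y * g y + - (2 * g x) * g y) = (g y - g x) ^+ 2.
  by ring.
exists (g x ^+ 2), (fun y => g y * g y + - (2 * g x) * g y), (k ^+ 2); split.
- by apply: AD; [exact: AM|exact: AZ].
- by move=> y; rewrite E sqr_ge0.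
- by rewrite E subrr expr0n.
- by rewrite sqr_ge0 exprn_gt0.
- move=> y /= ky; rewrite E -(real_normK (num_real (g y - g x))).
  by rewrite ler_pXn2r ?nnegrE// ltW.
Qed.

Lemma separable_from0 x : separable_from x set0.
Proof.
have [A0 _ _ _] := A_algebra.
by exists 0, (fun=> 0), 1; split=> // *; rewrite addr0.
Qed.

Hypothesis A_separates : separates_points A.

Lemma separable_from_compact x K : compact K -> ~ K x -> separable_from x K.
Proof.
move=> cK nKx; apply: compact_ind cK _ _ _ _.
- exact: separable_from0.
- exact: separable_fromS.
- exact: separable_fromU.
- move=> y Ky; have [|g Ag gyx] := @A_separates y x.
    by move=> yx; apply: nKx; rewrite -yx.
  have d0 : 0 < `|g y - g x| by rewrite normr_gt0 subr_eq0; exact/eqP.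
  have d2 : 0 < `|g y - g x| / 2 by rewrite divr_gt0.
  exists [set z | `|g y - g x| / 2 <= `|g z - g x|]; last first.
    exact: separable_from_level.
  near=> z => /=.
  have : `|g y - g z| < `|g y - g x| / 2.
    by near: z; apply: cvgr_dist_lt => //; exact: A_continuous.
  have := ler_distD (g z) (g y) (g x); lra.
Unshelve. all: by end_near.
Qed.

(** [A] need not contain constants, so the constant term [a ^+ n] is split off. *)
Lemma pow_algebra a h n : A h ->
  exists2 k, A k & forall y, (a + h y) ^+ n = a ^+ n + k y.
Proof.
move=> Ah; have [A0 AD AZ AM] := A_algebra.
elim: n => [|n [k Ak kE]].
  by exists (fun=> 0) => // y; rewrite !expr0 addr0.
exists (fun y => (a ^+ n * h y + a * k y) + h y * k y).
  by apply: (AD); [apply: (AD); exact: AZ|exact: AM].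
by move=> y; rewrite !exprS kE; ring.
Qed.

Hypothesis A_nowhere0 : vanishes_nowhere A.

(* If [a + h] vanishes at [x], is positive off [G] and at infinity, and is
   bounded by [N], then large powers of [1 - (a + h) / N] peak at [x];
   subtracting the value at infinity [(1 - a / N) ^+ n] yields a member of
   [A]. *)
Lemma peak_function x G (e : R) : open G -> G x -> 0 < e ->
  exists f, [/\ A f, 1 - e <= f x, forall y, f y <= 1
    & forall y, ~ G y -> f y <= e].
Proof.
move=> oG Gx e0; have [A0 AD AZ AM] := A_algebra.
have [g Ag gx0] := A_nowhere0 x.
have {gx0} gx0 : 0 < `|g x| by rewrite normr_gt0; exact/eqP.
have g2 : 0 < `|g x| / 2 by rewrite divr_gt0.
have cK : compact ([set y | `|g x| / 2 <= `|g y|] `\` G).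
  rewrite setDE; apply: compact_closedI; first exact: A_vanishing.
  exact: open_closedC.
have [|a [h [d [Ah h0 hx [a0 d0] hd]]]] := @separable_from_compact x _ cK.
  by case.
(* Off [G], the bound [d] is available only where [|g|] is at least [|g x| / 2]. Adding
   [(g y - g x) ^+ 2], which is at least [(|g x| / 2) ^+ 2] elsewhere and equals [g x ^+ 2] at
   infinity, gives a positive lower bound on the whole complement of [G] and at infinity. *)
pose b := a + g x ^+ 2.
pose k y := h y + (g y * g y + - (2 * g x) * g y).
have Ak : A k by apply: (AD h) => //; apply: (AD); [exact: AM|exact: AZ].
have kE y : b + k y = (a + h y) + (g y - g x) ^+ 2 by rewrite /b /k; ring.
have k0 y : 0 <= b + k y by rewrite kE addr_ge0 ?sqr_ge0.
have kx : b + k x = 0 by rewrite kE hx subrr expr0n addr0.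
pose d' := Num.min d ((`|g x| / 2) ^+ 2).
have d'0 : 0 < d' by rewrite lt_min d0 exprn_gt0.
have d'b : d' <= b.
  rewrite ge_min; apply/orP; right.
  rewrite /b expr_div_n real_normK ?num_real//.
  have := sqr_ge0 (g x); rewrite [X in _ / X](_ : _ = 4); last by ring.
  lra.
have kd y : ~ G y -> d' <= b + k y.
  move=> nGy; rewrite kE; have := h0 y; have := sqr_ge0 (g y - g x).
  have [gy|gy] := leP (`|g x| / 2) `|g y|.
    have := hd y (conj gy nGy); have := ge_min d d ((`|g x| / 2) ^+ 2).
    rewrite -/d' lexx /=; lra.
  suff : d' <= (g y - g x) ^+ 2 by lra.
  rewrite ge_min; apply/orP; right.
  rewrite -(real_normK (num_real (g y - g x))) ler_pXn2r ?nnegrE// ?ltW//.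
  by have := ler_normB (g y) (g y - g x); rewrite subKr; lra.
have [M kM] := algebra_bounded Ak.
(* [N] dominates every [b + k y] and also the value [b] at infinity, whence the maximum with 0; the
   1 makes it positive. *)
pose N := b + Num.max M 0 + 1.
have N0 : 0 < N.
  by rewrite ltr_pwDr// addr_ge0 ?le_max ?lexx ?orbT//; lra.
have bN : b <= N by rewrite /N; have := le_max 0 M 0; rewrite lexx orbT; lra.
have kN y : b + k y <= N.
  by rewrite /N; have := le_max M M 0; rewrite lexx /=; have := kM y; lra.
pose r := 1 - d' / N.
have r01 : 0 <= r < 1.
  by rewrite subr_ge0 ler_pdivrMr// mul1r gtrBl divr_gt0// (le_trans d'b).
have [n rn] : exists n, r ^+ n < e.
  have rn : r ^+ n @[n --> \oo] --> 0.
    by apply: cvg_expr; case/andP: r01 => r0 r1; rewrite ger0_norm.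
  by have /cvgr_lt/(_ _ e0)/filter_ex := rn.
have [f Af fE] := pow_algebra (1 - b / N) n (AZ (- N^-1) _ Ak).
have fE' y : f y = (1 - (b + k y) / N) ^+ n - (1 - b / N) ^+ n.
  by rewrite (_ : 1 - (b + k y) / N = 1 - b / N + - N^-1 * k y)
    ?fE; [rewrite addrC addKr|ring].
have sub01 z : 0 <= z -> z <= N -> 0 <= 1 - z / N <= 1.
  move=> z0 zN; rewrite subr_ge0 ler_pdivrMr// mul1r zN gerBl divr_ge0//.
  exact: ltW.
have /andP[c0 c1] : 0 <= 1 - b / N <= 1 by apply: sub01 => //; lra.
have cn : 0 <= (1 - b / N) ^+ n by rewrite exprn_ge0.
have small z : d' <= z -> z <= N -> (1 - z / N) ^+ n <= e.
  move=> dz zN; apply: le_trans (ltW rn); case/andP: r01 => r0 _.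
  have /andP[z0 _] : 0 <= 1 - z / N <= 1 by apply: sub01 => //; lra.
  by apply: lerXn2r; rewrite ?nnegrE ?lerB ?ler_pM2r ?invr_gt0.
exists f; split=> // [|y|y nGy]; rewrite fE'.
- by rewrite kx mul0r subr0 expr1n lerB// small.
- have /andP[q0 q1] := sub01 _ (k0 y) (kN y).
  by have := exprn_ile1 n q0 q1; lra.
- by have := small _ (kd _ nGy) (kN y); lra.
Qed.

End peak.

(** * Chernoff and moment bounds *)

Section estimates.
Variables (R : realType) (X : ptopologicalType) (m : probability (borel X) R).
Implicit Types (B C G : set (borel X)) (h : X -> R) (s a c d : R).

Lemma open_measurable_borel G : open (G : set X) -> measurable G.
Proof. exact: sub_sigma_algebra. Qed.

Lemma closed_measurable_borel B : closed (B : set X) -> measurable B.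
Proof.
move=> cB; rewrite -(setCK B); apply: measurableC.
by apply: open_measurable_borel; exact: closed_openC.
Qed.

Lemma continuous_measurable_borel h :
  continuous h -> measurable_fun [set: borel X] (h : borel X -> R).
Proof.
move=> /continuousP ch.
apply: (measurability _ (RGenOpens.measurableE R)) => _ [_ [x [y ->] <-]].
rewrite setTI; apply: open_measurable_borel; apply: ch.
exact: interval_open.
Qed.

Lemma measurable_exp s h : continuous h ->
  measurable_fun [set: borel X] (fun x : borel X => (expR (h x / s))%:E).
Proof.
move=> ch; apply/measurable_EFinP.
apply: (@continuous_measurable_borel (fun x => expR (h x / s))) => x.
apply: continuous_comp; last exact: continuous_expR.
by apply: continuousM; [exact: ch|exact: cvg_cst].
Qed.

Lemma poweR_mono s (x y : \bar R) : (0 < s)%R -> 0 <= x -> x <= y ->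
  x `^ s <= y `^ s.
Proof.
move=> s0 x0 xy; apply: gt0_ler_poweR => //; first exact: ltW.
- by rewrite in_itv /= x0 leey.
- by rewrite in_itv /= leey (le_trans x0).
Qed.

(** Markov's inequality for [expR (h / s)], raised to the power [s]. *)
Lemma exp_moment_ge s h a B : (0 < s)%R -> continuous h -> measurable B ->
  (forall x, B x -> (a <= h x)%R) ->
  (expR a)%:E * m B `^ s <= exp_moment m s h.
Proof.
move=> s0 ch mB ah; have mh := measurable_exp s ch.
have <- : ((expR (a / s))%:E * m B) `^ s = (expR a)%:E * m B `^ s.
  rewrite poweRM ?lee_fin ?expR_ge0// poweR_EFin -expRM divfK//.
  by rewrite gt_eqF.
apply: poweR_mono => //; first by rewrite mule_ge0// lee_fin expR_ge0.
apply: (@le_trans _ _ (\int[m]_(x in B) (expR (h x / s))%:E)).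
  rewrite -integral_cst//; apply: ge0_le_integral => //.
  - by move=> x _; rewrite /= lee_fin expR_ge0.
  - exact: measurable_funS mh.
  - move=> x /ah ax; rewrite lee_fin ler_expR ler_pM2r ?invr_gt0//.
apply: ge0_subset_integral => // x _; rewrite lee_fin; exact: expR_ge0.
Qed.

(** Over [G] the integrand is at most [expR (c / s)] and the mass at most [expR (- c / s)], so this
    part is at most 1, hence at most [expR (d / s)]; so is the part off [G]. Having two parts costs
    a factor 2 to the power [s], which tends to 1 as [s] tends to 0. *)
Lemma exp_moment_le s h c d G : (0 < s)%R -> continuous h ->
  open (G : set X) -> (0 <= d)%R -> (forall x, (h x <= c)%R) ->
  (forall x, ~ G x -> (h x <= d)%R) -> m G `^ s <= (expR (- c))%:E ->
  exp_moment m s h <= (2 `^ s * expR d)%:E.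
Proof.
move=> s0 ch oG d0 hc hd mGc; have mh := measurable_exp s ch.
have mG := open_measurable_borel oG.
have -> : (2 `^ s * expR d)%:E = (2 * (expR (d / s)))%:E `^ s.
  by rewrite poweR_EFin powRM ?expR_ge0// -expRM divfK ?gt_eqF.
apply: poweR_mono => //.
  by apply: integral_ge0 => x _; rewrite lee_fin expR_ge0.
have mGs : m G <= (expR (- c / s))%:E.
  have -> : m G = (m G `^ s) `^ s^-1.
    by rewrite -poweRrM divff ?gt_eqF// poweRe1.
  rewrite expRM -poweR_EFin; apply: poweR_mono; rewrite ?invr_gt0//.
  exact: poweR_ge0.
rewrite -(setUv G) ge0_integral_setU//; first last.
- by apply/eqP; rewrite setICr.
- by rewrite setUv.
- exact: measurableC.
rewrite mulr_natl mulr2n EFinD; apply: leeD.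
  apply: (@le_trans _ _ (\int[m]_(x in G) cst (expR (c / s))%:E x)).
    apply: ge0_le_integral => //.
    - exact: measurable_funS mh.
    - by move=> x _; rewrite lee_fin ler_expR ler_pM2r ?invr_gt0.
  rewrite integral_cst//.
  apply: (@le_trans _ _ ((expR (c / s))%:E * (expR (- c / s))%:E)).
    by rewrite lee_pmul2l// lte_fin expR_gt0.
  rewrite -EFinM -expRD mulNr subrr expR0 lee_fin -expR0 ler_expR.
  by rewrite divr_ge0// ltW.
apply: (@le_trans _ _ (\int[m]_(x in ~` G) cst (expR (d / s))%:E x)).
  apply: ge0_le_integral => //.
  - exact: measurableC.
  - by apply: measurable_funS mh => //; exact: measurableC.
  - by move=> x nGx; rewrite lee_fin ler_expR ler_pM2r ?invr_gt0 ?hd.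
rewrite integral_cst//; last exact: measurableC.
rewrite -[leRHS]mule1 lee_pmul2l// ?lte_fin ?expR_gt0//; apply: probability_le1.
exact: measurableC.
Qed.

(** The union has at most twice the larger of the two measures. *)
Lemma power_setU_le s B C c : (0 < s)%R -> measurable B -> measurable C ->
  m B `^ s <= c%:E -> m C `^ s <= c%:E -> m (B `|` C) `^ s <= (2 `^ s * c)%:E.
Proof.
move=> s0 mB mC Bc Cc.
apply: (@le_trans _ _ ((2%:E * maxe (m B) (m C)) `^ s)).
  apply: poweR_mono => //.
  apply: (le_trans (measureU2 _ mB mC)).
  rewrite mule_natl mule2n; apply: leeD; rewrite le_max lexx ?orbT//.
rewrite poweRM// ?le_max ?measure_ge0// poweR_EFin EFinM.
apply: lee_wpmul2l; first by rewrite lee_fin powR_ge0.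
by rewrite maxEle; case: ifP.
Qed.

End estimates.

(** * Inequalities for the extended logarithm *)

Section lne_bounds.
Variable R : realType.

Lemma lne_le (x : \bar R) (d : R) : x <= (expR d)%:E -> lne x <= d%:E.
Proof.
move=> xd; have [x0|x0] := leP x 0; first by rewrite le0_lneNy// leNye.
by rewrite -(expeRK d%:E) lee_lne// in_itv /= leey ?(ltW x0) ?lee_fin ?expR_ge0.
Qed.

Lemma lne_lt (x : \bar R) (d : R) : lne x < d%:E -> x < (expR d)%:E.
Proof.
rewrite !ltNge; apply: contra => dx.
have x0 : 0 <= x by apply: le_trans dx; rewrite lee_fin expR_ge0.
by rewrite -(expeRK d%:E) lee_lne// in_itv /= leey ?x0 ?lee_fin ?expR_ge0.
Qed.

Lemma lne_mono (x y : \bar R) : x <= y -> lne x <= lne y.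
Proof.
move=> xy; have [x0|x0] := leP x 0; first by rewrite le0_lneNy// leNye.
by rewrite lee_lne// in_itv /= leey ltW// (lt_le_trans x0).
Qed.

(** Infinite [L] is allowed, so [Lambda] need never be shown to be finite. *)
Lemma lt_fin_sub (a r : R) (L : \bar R) :
  (a%:E < r%:E - L) = (L < (r - a)%:E).
Proof.
case: L => [l| |] /=; last by rewrite ltNyr ltry.
  by rewrite !lte_fin ltrBrDl ltrBrDl addrC.
by rewrite ltNge leNye ltNge leey.
Qed.

End lne_bounds.

(** * The large deviation principle *)

Section ldp.
Variables (R : realType) (X : ptopologicalType) (J : Type).
Variables (le : J -> J -> Prop) (nu : J -> probability (borel X) R).
Variables (s : J -> R) (A : set (X -> R)).
Hypothesis le_directed : directed le.
Hypothesis s_gt0 : forall j, (0 < s j)%R.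
Hypothesis s_cvg0 : s j @[j --> tails le] --> 0%R.
(* Holds when [nu] and [s] are subnets along a universal subnet. *)
Hypothesis universal : forall (f : probability (borel X) R -> R -> \bar R) B,
  let u := fun j => f (nu j) (s j) in
  (u @ tails le) B \/ (u @ tails le) (~` B).
Hypothesis A_algebra : function_algebra A.
Hypothesis A_continuous : forall h, A h -> continuous h.
Hypothesis A_vanishing : forall h, A h -> vanishes_at_infinity h.
Hypothesis A_separates : separates_points A.
Hypothesis A_nowhere0 : vanishes_nowhere A.

Let FF : ProperFilter (tails le) := tails_filter le_directed.
Local Existing Instance FF.

Local Notation cap B := (net_limsup le (fun j => nu j B `^ s j)).
Local Notation rate := (rate_of le nu s A).

(** * Capacities and the functional [Lambda] along the universal subnet *)

Lemma cap_liminf B : net_liminf le (fun j => nu j B `^ s j) = cap B.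
Proof.
apply: liminf_eq_limsup; exact: (universal (fun m t => m B `^ t)).
Qed.

Lemma exp_moment_cvg h : exp_moment (nu j) (s j) h @[j --> tails le] -->
  net_limsup le (fun j => exp_moment (nu j) (s j) h).
Proof.
apply: cvg_limsup; exact: (universal (fun m t => exp_moment m t h)).
Qed.

Lemma LambdaE h :
  Lambda le nu s h = lne (net_limsup le (fun j => exp_moment (nu j) (s j) h)).
Proof. by rewrite /Lambda (cvg_lim _ (@exp_moment_cvg h)). Qed.

(** It suffices that [s j] be below [ln (y / z) / ln 2]. This absorbs the factors left by splitting
    into two pieces. *)
Lemma near_pow2 (y z : R) : (0 < z)%R -> (z < y)%R ->
  \forall j \near tails le, (2 `^ s j * z <= y)%R.
Proof.
move=> z0 zy.
have ln2 : (0 < ln 2 :> R)%R by rewrite ln_gt0// ltr1n.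
have lnyz : (0 < ln (y / z))%R by rewrite ln_gt0// ltr_pdivlMr// mul1r.
have k0 : (0 < ln (y / z) / ln 2)%R by rewrite divr_gt0.
have : \forall j \near tails le, (s j < ln (y / z) / ln 2)%R.
  by apply: (cvgr_lt 0%R).
apply: filterS => j; rewrite ltr_pdivlMr// => /ltW sj.
rewrite -ler_pdivlMr// /powR pnatr_eq0/= -[leRHS]lnK ?posrE ?ler_expR//.
by rewrite divr_gt0// (lt_trans z0).
Qed.

Lemma cap_setU (B C : set (borel X)) c : measurable B -> measurable C ->
  cap B <= c -> cap C <= c -> cap (B `|` C) <= c.
Proof.
move=> mB mC Bc Cc; apply: lte_le_real => y /lte_between[z [cz zy]].
have Bz : \forall j \near tails le, nu j B `^ s j < z%:E.
  by apply: near_lt_limsup; exact: le_lt_trans cz.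
have Cz : \forall j \near tails le, nu j C `^ s j < z%:E.
  by apply: near_lt_limsup; exact: le_lt_trans cz.
have z0 : (0 < z)%R.
  have [j] := filter_ex Bz.
  by rewrite -lte_fin; apply: le_lt_trans; exact: poweR_ge0.
apply: le_limsup_near; near=> j.
apply: (@le_trans _ _ (2 `^ s j * z)%:E); last first.
  by rewrite lee_fin; near: j; exact: near_pow2.
by apply: power_setU_le => //; apply: ltW; near: j.
Unshelve. all: by end_near.
Qed.

Lemma cap_chernoff h (a y : R) (B : set (borel X)) : A h -> measurable B ->
  (forall x, B x -> (a <= h x)%R) -> Lambda le nu s h < y%:E ->
  cap B <= (expR (y - a))%:E.
Proof.
move=> Ah mB aB; rewrite LambdaE => /lne_lt/near_lt_limsup hy.
apply: le_limsup_near; apply: filterS hy => j hy.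
have := exp_moment_ge (nu j) (s_gt0 j) (A_continuous Ah) mB aB.
move=> /le_trans /(_ (ltW hy)).
by rewrite expRD expRN EFinM lee_pdivlMr// ?expR_gt0// muleC.
Qed.

(** Some [h] in [A] admits [y] with [Lambda h < y < h x - d]; Chernoff's bound on the set
    [h > y + d] has exponent [y - (y + d)]. *)
Lemma cap_nbhs_rate x (d : R) : d%:E < rate x ->
  exists V : set X, [/\ open V, V x & cap V <= (expR (- d))%:E].
Proof.
move=> /ereal_sup_gt[_ [h Ah <-]]; rewrite lt_fin_sub.
move=> /lte_between[y [hy]]; rewrite lte_fin => yx.
have oV : open [set z | (y + d < h z)%R].
  by apply: (open_comp _ (@open_gt _ _)) => z _; exact: A_continuous.
exists [set z | (y + d < h z)%R]; split=> //=; first by lra.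
have -> : (- d = y - (y + d))%R by lra.
apply: (cap_chernoff Ah) => //; first exact: open_measurable_borel.
by move=> z /ltW.
Qed.

(** For [Lambda h < y < - d] the level [- d - y] is positive, so the set where [|h|] reaches it is
    compact; off this set [h] exceeds [d + y], and Chernoff's bound applies. *)
Lemma cap_infinity h (d : R) : A h -> d%:E < - Lambda le nu s h ->
  exists K : set X, [/\ compact K, closed K & cap (~` K) <= (expR (- d))%:E].
Proof.
move=> Ah; rewrite -[X in _ < X]add0e lt_fin_sub sub0r.
move=> /lte_between[y [hy]]; rewrite lte_fin => yd.
have e0 : (0 < - d - y)%R by lra.
have cK : closed [set z | (- d - y <= `|h z|)%R].
  apply: (closed_comp _ (@closed_ge _ _)) => z _.
  by apply: continuous_comp; [exact: A_continuous|exact: norm_continuous].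
exists [set z | (- d - y <= `|h z|)%R]; split => //; first exact: A_vanishing.
rewrite [leRHS](_ : _ = (expR (y - (d + y)))%:E); last first.
  by congr (expR _)%:E; lra.
apply: (cap_chernoff Ah) => //.
  by apply: measurableC; exact: closed_measurable_borel.
move=> z /negP; rewrite -ltNge ltr_norml => /andP[]; lra.
Qed.

(** Take [f] peaking at [x] inside [G] with tolerance [d / (2 * c)]. The small mass of [G] offsets
    the height [c] of [c * f], so [Lambda] of [c * f] is at most [d / 2], while [c * f x] is at
    least [c - d / 2]. *)
Lemma rate_ge_cap (G : set X) x (c : R) : open G -> G x -> (0 < c)%R ->
  cap G < (expR (- c))%:E -> c%:E <= rate x.
Proof.
move=> oG Gx c0 Gc; apply/lee_addgt0Pr => d d0.
have e0 : (0 < d / (2 * c))%R by rewrite divr_gt0 ?mulr_gt0.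
have [f [Af fx f1 fe]] := peak_function A_algebra A_continuous A_vanishing
  A_separates A_nowhere0 oG Gx e0.
have [_ _ AZ _] := A_algebra.
have Ah := AZ c _ Af.
have cE : (c * (d / (2 * c)) = d / 2)%R by field; rewrite gt_eqF.
have L : Lambda le nu s (fun x => c * f x)%R <= (d / 2)%:E.
  rewrite LambdaE; apply/lne_le/lte_le_real => y; rewrite lte_fin => dy.
  have {}Gc : \forall j \near tails le, nu j G `^ s j < (expR (- c))%:E.
    exact: near_lt_limsup.
  apply: le_limsup_near.
  apply: filterS2 Gc (near_pow2 (expR_gt0 _) dy) => j Gj yj.
  apply: (@le_trans _ _ (2 `^ s j * expR (d / 2))%:E); last first.
    by rewrite lee_fin.
  apply: (exp_moment_le (s_gt0 j) (A_continuous Ah) oG _ _ _ (ltW Gj)).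
  - lra.
  - by move=> z; rewrite ger_pMr.
  - by move=> z /fe; rewrite -cE ler_pM2l.
rewrite -leeBlDr// -EFinB.
apply: (@le_trans _ _ ((c * f x)%:E - (d / 2)%:E)).
  by rewrite -EFinB lee_fin; have := ler_wpM2l (ltW c0) fx; lra.
apply: (@le_trans _ _ ((c * f x)%:E - Lambda le nu s (fun x => c * f x)%R)).
  exact: leeB.
by apply: ereal_sup_ubound; exists (fun x => c * f x)%R.
Qed.

Lemma rate_ge0 x : 0 <= rate x.
Proof.
have [A0 _ _ _] := A_algebra.
apply: (@le_trans _ _ (0%:E - Lambda le nu s (fun=> 0%R))); last first.
  by apply: ereal_sup_ubound; exists (fun=> 0%R).
rewrite sub0e oppe_ge0 LambdaE; apply/lne_le; apply: le_limsup_near.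
apply: nearW => j; rewrite /exp_moment.
under eq_integral do rewrite mul0r expR0.
rewrite integral_cst// mul1e.
by rewrite [X in X `^ _](_ : _ = 1) ?poweR1r ?expR0//; exact: probability_setT.
Qed.

Lemma rate_lower_semicontinuous : lower_semicontinuous rate.
Proof.
move=> x a /ereal_sup_gt[_ [h Ah <-]]; rewrite lt_fin_sub.
move=> /lte_between[y [hy]]; rewrite lte_fin => yx.
exists [set z | (y + a < h z)%R].
  by apply: (cvgr_gt (h x)); [exact: A_continuous|lra].
move=> z /= yz; apply: (@lt_le_trans _ _ ((h z)%:E - Lambda le nu s h)).
  by rewrite lt_fin_sub; apply: lt_le_trans hy _; rewrite lee_fin; lra.
by apply: ereal_sup_ubound; exists h.
Qed.

Lemma rate_open_bound (G : set X) x : open G -> G x ->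
  expeR (- rate x) <= cap G.
Proof.
move=> oG Gx; rewrite leNgt; apply/negP => /lte_between[y [Gy yx]].
have y0 : (0 < y)%R.
  rewrite -lte_fin; apply: le_lt_trans Gy; rewrite -cap_liminf.
  by apply: le_liminf_near; apply: nearW => j; exact: poweR_ge0.
(* With [c = - ln y] the inequalities become [cap G < expR (- c)] and [rate x < c]. The second gives
   [c > 0], and then [rate_ge_cap] contradicts it. *)
rewrite -(lnK (y0 : y \is Num.pos)) -[ln y]opprK in Gy yx.
move: yx; rewrite -[(expR _)%:E]/(expeR (- _)%:E) lte_expeR EFinN lteN2.
move=> yx; have := yx; rewrite ltNge => /negP; apply.
apply: rate_ge_cap Gy => //.
by rewrite -lte_fin; apply: le_lt_trans yx; exact: rate_ge0.
Qed.

Lemma le_cap (B C : set (borel X)) : measurable B -> measurable C ->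
  B `<=` C -> cap B <= cap C.
Proof.
move=> mB mC BC; apply: lte_le_real => y Cy.
have {}Cy : \forall j \near tails le, nu j C `^ s j < y%:E.
  exact: near_lt_limsup.
apply: le_limsup_near; apply: filterS Cy => j /ltW; apply: le_trans.
by apply: poweR_mono => //; apply: le_measure; rewrite ?inE.
Qed.

(** Bounding an open [V] around the set gives a property of arbitrary subsets that is hereditary
    under inclusion, as [compact_ind] requires. *)
Lemma cap_compact (K : set X) (d : R) : compact K ->
  (forall x, K x -> d%:E < rate x) ->
  exists V : set X, [/\ open V, K `<=` V & cap V <= (expR (- d))%:E].
Proof.
move=> cK Kd; pose P (C : set X) := exists V : set X,
  [/\ open V, C `<=` V & cap V <= (expR (- d))%:E].
apply: (compact_ind (P := P) cK).
- exists set0; split => //; first exact: open0.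
  apply: le_limsup_near; apply: nearW => j.
  by rewrite measure0 poweR0r ?lee_fin ?expR_ge0// gt_eqF.
- by move=> C D CD [V [oV DV Vd]]; exists V; split=> //; exact: subset_trans DV.
- move=> C D [V [oV CV Vd]] [W [oW DW Wd]]; exists (V `|` W); split.
  + exact: openU.
  + exact: setUSS.
  + by apply: cap_setU => //; exact: open_measurable_borel.
- move=> x /Kd /cap_nbhs_rate[V [oV Vx Vd]].
  by exists V; [exact: open_nbhs_nbhs|exists V; split].
Qed.

(** * Control at infinity: closed sets and tightness *)

Hypothesis rate_le_infinity :
  ereal_sup [set rate x | x in [set: X]] <=
  ereal_sup [set - Lambda le nu s h | h in A].

Lemma exists_cap_infinity x (d : R) : d%:E < rate x ->
  exists K : set X, [/\ compact K, closed K & cap (~` K) <= (expR (- d))%:E].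
Proof.
move=> dx; have : d%:E < ereal_sup [set - Lambda le nu s h | h in A].
  apply: lt_le_trans rate_le_infinity; apply: lt_le_trans dx _.
  by apply: ereal_sup_ubound; exists x.
by move=> /ereal_sup_gt[_ [h Ah <-]]; exact: cap_infinity.
Qed.

Lemma rate_closed_bound (F : set X) : closed F -> cap F <= sup_expN rate F.
Proof.
move=> cF; apply: lte_le_real => y Fy.
have y0 : (0 < y)%R.
  rewrite -lte_fin; apply: le_lt_trans Fy.
  by apply: ereal_sup_ubound; left.
have Fd x : F x -> (- ln y)%:E < rate x.
  move=> Fx; rewrite EFinN -lteN2 oppeK -lte_expeR /= lnK ?posrE//.
  by apply: le_lt_trans Fy; apply: ereal_sup_ubound; right; exists x.
(* The compact [K] below is obtained from a point of [F], so empty [F] is treated apart. *)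
have [->|/set0P[x Fx]] := eqVneq F set0.
  apply: le_limsup_near; apply: nearW => j.
  by rewrite measure0 poweR0r ?lee_fin ?ltW// gt_eqF.
have [K [cK clK Kd]] := exists_cap_infinity (Fd _ Fx).
(* [V] covers the part of [F] in [K], and the rest of [F] lies off [K]; with exponent [- ln y] both
   pieces have capacity at most [y]. *)
have [V [oV FKV Vd]] := cap_compact (compact_closedI cK cF)
  (fun z (Fz : (K `&` F) z) => Fd z Fz.2).
rewrite opprK lnK ?posrE// in Kd Vd.
have mV := open_measurable_borel oV.
have mK : measurable (~` K : set (borel X)).
  by apply: measurableC; exact: closed_measurable_borel.
apply: le_trans (cap_setU mV mK Vd Kd).
apply: le_cap; [exact: closed_measurable_borel|exact: measurableU|].
move=> z Fz; have [Kz|nKz] := pselect (K z); last by right.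
by left; exact: FKV.
Qed.

(** For [d < rate x], some closed compact [K] has a complement of capacity at most [expR (- d)]; the
    lower bound on this open complement forces the rate to be at least [d] at each of its points. *)
Lemma rate_tight : ereal_sup [set rate x | x in [set: X]] <=
  ereal_sup [set ereal_inf [set rate x | x in ~` K]
            | K in [set K : set X | compact K]].
Proof.
apply: ge_ereal_sup => _ [x _ <-]; rewrite leNgt.
apply/negP => /lte_between[d [Kd dx]].
have [K [cK clK capK]] := exists_cap_infinity dx.
move: Kd; rewrite ltNge => /negP; apply.
apply: (@le_trans _ _ (ereal_inf [set rate x | x in ~` K])); last first.
  by apply: ereal_sup_ubound; exists K.
apply: le_ereal_inf_tmp => _ [z Kz <-].
have := le_trans (rate_open_bound (closed_openC clK) Kz) capK.
by rewrite -[(expR _)%:E]/(expeR (- _)%:E) lee_expeR EFinN leeN2.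
Qed.

Lemma rate_LDP : LDP_with_rate le nu s rate.
Proof.
(* Being lower semicontinuous, [rate] is its own lower regularization and can serve as [l]. *)
exists rate; split; first exact: rate_ge0.
- split=> [F|G]; first exact: rate_closed_bound.
  move=> oG; rewrite cap_liminf; apply: ge_ereal_sup => _ [->|[x Gx <-]].
    rewrite -cap_liminf.
    by apply: le_liminf_near; apply: nearW => j; exact: poweR_ge0.
  exact: rate_open_bound.
- by split=> //; exact: rate_lower_semicontinuous.
Qed.

End ldp.

Theorem corollary5 (R : realType) (X : ptopologicalType)
  (X_not_point : ~ exists x : X, [set: X] = [set x])
  (compact_borel : forall K : set X, compact K -> <<s @open X >> K)
  (X_lc : locally_compact_space X)
  (X_regular : regular_space X)
  (I : Type) (le : I -> I -> Prop) (le_directed : directed le)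
  (mu : I -> probability (borel X) R)
  (t : I -> R) (t_gt0 : forall i, (0 < t i)%R)
  (t_cvg0 : t i @[i --> tails le] --> 0%R)
  (A : set (X -> R))
  (A_algebra : function_algebra A)
  (A_continuous : forall h, A h -> continuous h)
  (A_vanishing : forall h, A h -> vanishes_at_infinity h)
  (A_separates : separates_points A)
  (A_nowhere0 : vanishes_nowhere A)
  (Lambda_ineq :
     ereal_sup [set (h x)%:E - Lambda_inf le mu t h | x in [set: X] & h in A]
     <= ereal_sup [set - Lambda_sup le mu t h | h in A]) :
  exists (J : Type) (leJ : J -> J -> Prop) (phi : J -> I),
    let nu := fun j => mu (phi j) in
    let s := fun j => t (phi j) in
    let rate := rate_of leJ nu s A in
    [/\ subnet_map le leJ phi,
        (forall h, A h -> Lambda_exists leJ nu s h),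
        LDP_with_rate leJ nu s rate
      & ereal_sup [set rate x | x in [set: X]]
        <= ereal_sup [set ereal_inf [set rate x | x in ~` K]
                     | K in [set K : set X | compact K]]].
Proof.
have [J [leJ [phi [sub ultra]]]] := universal_subnet le_directed.
exists J, leJ, phi => nu s rate.
have leJ_directed : directed leJ by have [] := sub.
have FF := tails_filter le_directed; have FFJ := tails_filter leJ_directed.
have s_gt0 j : (0 < s j)%R by exact: t_gt0.
have s_cvg0 : s j @[j --> tails leJ] --> 0%R.
  by move=> B /t_cvg0 tB; exact: subnet_tails sub tB.
have universal (f : probability (borel X) R -> R -> \bar R) B :
    let u := fun j => f (nu j) (s j) in
    (u @ tails leJ) B \/ (u @ tails leJ) (~` B).
  exact: (ultra [set i | B (f (mu i) (t i))]).
have LE := LambdaE leJ_directed universal.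
(* Along a subnet the limsup can only drop and the liminf only rise, so [Lambda] lies between
   [Lambda_inf] and [Lambda_sup] of the original net; this carries [Lambda_ineq] over to the
   subnet. *)
have sup_Lambda h : Lambda leJ nu s h <= Lambda_sup le mu t h.
  rewrite LE; apply: lne_mono; apply: lte_le_real => y hy.
  have {}hy : \forall i \near tails le, exp_moment (mu i) (t i) h < y%:E.
    exact: near_lt_limsup.
  apply: le_limsup_near.
  by apply: filterS (subnet_tails sub hy) => j /ltW.
have inf_Lambda h : Lambda_inf le mu t h <= Lambda leJ nu s h.
  rewrite LE; apply: lne_mono; rewrite leNgt; apply/negP.
  move=> /lte_between[y [hy yh]].
  have {}yh : \forall i \near tails le, y%:E < exp_moment (mu i) (t i) h.
    exact: near_lt_liminf.
  have {}hy : \forall j \near tails leJ, exp_moment (nu j) (s j) h < y%:E.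
    exact: near_lt_limsup.
  have [j [/ltW]] := filter_ex (filterI hy (subnet_tails sub yh)).
  by rewrite leNgt => /negP.
have rate_le_infinity : ereal_sup [set rate x | x in [set: X]] <=
    ereal_sup [set - Lambda leJ nu s h | h in A].
  apply: (@le_trans _ _ (ereal_sup [set - Lambda_sup le mu t h | h in A])).
    apply: le_trans Lambda_ineq; apply: ge_ereal_sup => _ [x _ <-].
    apply: ge_ereal_sup => _ [h Ah <-].
    apply: (@le_trans _ _ ((h x)%:E - Lambda_inf le mu t h)); first exact: leeB.
    by apply: ereal_sup_ubound; exists x => //; exists h.
  apply: ge_ereal_sup => _ [h Ah <-].
  apply: (@le_trans _ _ (- Lambda leJ nu s h)); first by rewrite leeN2.
  by apply: ereal_sup_ubound; exists h.
split=> //.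
- by move=> h _; apply/cvg_ex; eexists; exact: exp_moment_cvg.
- exact: rate_LDP.
- exact: rate_tight.
Qed.
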